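(* Let $n,k\ge 1$ and let $[n]^3$ denote the complete $3$-partite $3$-uniform hypergraph with three disjoint sides $V_1,V_2,V_3$, each of size $n$, whose edges are all triples meeting each $V_j$ in exactly one vertex. If $F_1,\ldots,F_k\subseteq [n]^3$ satisfy $|F_i|>(k-1)n^{2}$ for all $i\le k$, then there exist pairwise disjoint edges $e_1,\ldots,e_k$ with $e_i\in F_i$ for every $i$ (a rainbow matching).
   Context: A rainbow matching for a collection $(F_1,\ldots,F_k)$ of hypergraphs is a choice of pairwise disjoint edges $e_i\in F_i$, one from each $F_i$. *)

(* Defs.v *)
From mathcomp Require Import all_boot.
Set Implicit Arguments. Unset Strict Implicit. Unset Printing Implicit Defensive.

(* The complete 3-partite 3-uniform hypergraph [n]^3.
   Vertex set: V_1 u V_2 u V_3, encoded as pairs (j, x) with side j : 'I_3 and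
   x : 'I_n, so the three sides are disjoint and each has n vertices.
   An edge is determined by a triple t = (x1, x2, x3) and is the vertex set
   {(0,x1), (1,x2), (2,x3)}; these are exactly the triples meeting each side
   in exactly one vertex. *)
Definition vertex (n : nat) := ('I_3 * 'I_n)%type.
Definition triple (n : nat) := ('I_n * 'I_n * 'I_n)%type.

Definition coord (n : nat) (t : triple n) (j : 'I_3) : 'I_n :=
  match val j with 0 => t.1.1 | 1 => t.1.2 | _ => t.2 end.

Definition edge_vset (n : nat) (t : triple n) : {set vertex n} :=
  [set v | v.2 == coord t v.1].

Definition rainbow_matching (n k : nat) (F : 'I_k -> {set triple n})
  (e : 'I_k -> triple n) : Prop :=
  (forall i, e i \in F i) /\
  (forall i j, i != j -> [disjoint edge_vset (e i) & edge_vset (e j)]).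

(* Main.v *)
Require Import Defs.
From mathcomp Require Import all_boot.
From mathcomp Require Import zify.
Set Implicit Arguments. Unset Strict Implicit. Unset Printing Implicit Defensive.

(** Write k = K + 1 and n = K + d.  Compressing the families along each side
    turns them into downsets of {0, ..., n-1}^3 of the same size, and rainbow
    matchings pull back along a compression.

    Induction on k.  If (0, K, K) belongs to some F_c, delete the layer x = 0
    from the other families, match them by induction, and extend: the K edges
    leave some y <= K and z <= K free, and (0, y, z) is in F_c.  The same holds
    for (K, 0, K) and (K, K, 0).

    Otherwise no F_i has a point with two coordinates >= K.  Counting then gives
    d < K, that F_i contains (a, b, K) whenever a + b <= d, and that F_i misses
    fewer than d K^2 points with z < K.  Consider n disjoint slots: the d slots
    (a, d-1-a, K), which fit every colour (the repeated third coordinate K is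
    repaired at the end by ranking), and the K slots
    (d + (j+r mod K), d + (j+s mod K), j).  For suitable r and s the total number
    of misfits between colours and slots is less than k d, and then assigning
    slots greedily, the most constrained colours first, succeeds. *)

(** * Greedy systems of distinct representatives *)

(** The index [i0] with the largest [D i0] is served last: all indices in play are counted by the
    hypothesis at [i0], so the representatives of the others cannot exhaust [D i0]. *)
Lemma greedy_sdr (I T : finType) (t0 : T) (D : I -> {set T}) :
  (forall i, #|[set j | #|D j| <= #|D i|]| <= #|D i|) ->
  exists2 f : I -> T, injective f & forall i, f i \in D i.
Proof.
move=> cardD.
suff: forall m (A : {set I}), #|A| = m ->
    exists2 f : I -> T, {in A &, injective f} & {in A, forall i, f i \in D i}.
  case/(_ _ setT erefl) => f f_inj fD.
  by exists f => [i j|i]; [apply: f_inj; rewrite inE | apply: fD; rewrite inE].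
elim=> [|m IHm] A cardA.
  by exists (fun=> t0) => i; rewrite (cards0_eq cardA) inE.
have [i1 Ai1] : exists i, i \in A by apply/set0Pn; rewrite -card_gt0 cardA.
have [i0 Ai0 max_i0] := arg_maxnP (fun i => #|D i|) Ai1.
have {}Ai0 : i0 \in A := Ai0.
have cardA0 : #|A :\ i0| = m by move: (cardsD1 i0 A); rewrite Ai0 cardA; lia.
have [f f_inj fD] := IHm _ cardA0.
have leAD : #|A| <= #|D i0|.
  apply: leq_trans (cardD i0); apply: subset_leq_card.
  by apply/subsetP => j Aj; rewrite inE; apply: max_i0.
have [t Dt nft] : exists2 t, t \in D i0 & t \notin f @: (A :\ i0).
  apply/subsetPn; apply/negP => /subset_leq_card/(leq_trans leAD).
  by move=> /leq_trans/(_ (leq_imset_card _ _)); rewrite cardA0 cardA ltnn.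
have nf j : j \in A -> j != i0 -> f j != t.
  move=> Aj ji0; apply: contraNneq nft => <-.
  by apply: imset_f; rewrite !inE ji0.
exists (fun i => if i == i0 then t else f i) => [i j Ai Aj|i Ai] /=.
  case: eqP => [->|/eqP ii0]; case: eqP => [->|/eqP ji0] //.
  - by move/esym/eqP; rewrite (negPf (nf _ Aj ji0)).
  - by move/eqP; rewrite (negPf (nf _ Ai ii0)).
  - by apply: f_inj; rewrite !inE ?ii0 ?ji0.
case: eqP => [->//|/eqP ii0]; by apply: fD; rewrite !inE ii0.
Qed.

(** * Families as predicates on triples of naturals, and their compression *)

Definition vol n (f : nat -> nat -> nat -> nat) :=
  \sum_(x < n) \sum_(y < n) \sum_(z < n) f x y z.

Definition card3 n (f : nat -> nat -> nat -> bool) :=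
  vol n (fun x y z => f x y z).

Definition rainbow n k (F : 'I_k -> nat -> nat -> nat -> bool) :=
  exists x y z : 'I_k -> nat,
    [/\ injective x, injective y, injective z,
        (forall i, [/\ x i < n, y i < n & z i < n])
      & forall i, F i (x i) (y i) (z i)].

Definition down3 (f : nat -> nat -> nat -> bool) :=
  forall x y z z', z' <= z -> f x y z -> f x y z'.
Definition down2 (f : nat -> nat -> nat -> bool) :=
  forall x y z y', y' <= y -> f x y z -> f x y' z.
Definition down1 (f : nat -> nat -> nat -> bool) :=
  forall x y z x', x' <= x -> f x y z -> f x' y z.

Definition rot (f : nat -> nat -> nat -> bool) x y z := f z x y.

(** The first coordinate is compressed and moved to the third place, so three applications compress
    every side and restore the order of the coordinates. *)
Definition compress n (f : nat -> nat -> nat -> bool) x y z :=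
  z < \sum_(a < n) f a x y.

Lemma sum_bool_le n (b : nat -> bool) : \sum_(x < n) b x <= n.
Proof.
by rewrite -[leqRHS]card_ord -sum1_card; apply: leq_sum => i _; apply: leq_b1.
Qed.

Lemma sum_interval n a b : b <= n -> \sum_(x < n) (a <= x < b) = b - a.
Proof.
elim: n b => [|n IHn] b leb; first by rewrite big_ord0; lia.
rewrite big_ord_recr /=; case: (ltnP n b) => [nb|bn].
  have -> : b = n.+1 by lia.
  rewrite (eq_bigr (fun x : 'I_n => (a <= x < n) : nat)).
    by rewrite IHn // andbT; case: leqP; lia.
  by move=> x _; congr (nat_of_bool (_ && _)); rewrite ltn_ord ltnS ltnW.
by rewrite IHn // andbF addn0.
Qed.

Lemma card3_rot n (f : nat -> nat -> nat -> bool) :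
  card3 n (rot f) = card3 n f.
Proof.
rewrite /card3 /vol /rot.
under eq_bigr => x _ do rewrite exchange_big.
by rewrite exchange_big.
Qed.

Lemma card3_compress n (f : nat -> nat -> nat -> bool) :
  card3 n (compress n f) = card3 n f.
Proof.
rewrite -(card3_rot n f) /card3 /vol; apply: eq_bigr => x _; apply: eq_bigr => y _.
rewrite /compress /rot.
by rewrite (sum_interval 0 (sum_bool_le n (fun a => f a x y))) subn0.
Qed.

Lemma rainbow_rot n k (F : 'I_k -> nat -> nat -> nat -> bool) :
  rainbow n (fun i => rot (F i)) -> rainbow n F.
Proof.
move=> [x [y [z [xI yI zI lt_n Fxyz]]]]; exists z, x, y; split=> // i.
by have [] := lt_n i.
Qed.

(** Indices [j] with [#|D j| <= #|D i|] have distinct values [z j] below [#|D i|], so there are at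
    most [#|D i|] of them. This is the condition of [greedy_sdr] for the fibres [D]. *)
Lemma rainbow_compress n k (F : 'I_k -> nat -> nat -> nat -> bool) :
  rainbow n (fun i => compress n (F i)) -> rainbow n F.
Proof.
move=> [x [y [z [xI yI zI lt_n Fxyz]]]].
pose D i := [set a : 'I_n | F i a (x i) (y i)].
have cardD i : #|D i| = \sum_(a < n) F i a (x i) (y i).
  by rewrite -sum1dep_card big_mkcond; apply: eq_bigr => a _; case: (F i).
have ltzD i : z i < #|D i| by rewrite cardD; apply: Fxyz.
have le_n i : #|D i| <= n by rewrite -[leqRHS]card_ord max_card.
case: n => [|n] in lt_n Fxyz D cardD ltzD le_n *.
  by exists x, y, z; split=> // i; have [] := lt_n i.
have [|a aI aD] := @greedy_sdr _ _ ord0 D.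
  move=> i; rewrite -[leqRHS]card_ord.
  have zI' : {in [set j | #|D j| <= #|D i|] &,
      injective (fun j => insubd (Ordinal (ltzD i)) (z j))}.
    move=> j j'; rewrite !inE => lej lej' /(congr1 val).
    have lt1 := leq_trans (ltzD j) lej; have lt2 := leq_trans (ltzD j') lej'.
    by rewrite !val_insubd lt1 lt2; apply: zI.
  by rewrite -(card_in_imset zI') max_card.
exists (fun i => nat_of_ord (a i)), x, y; split=> // [i j /val_inj/aI//|i|i].
  by have [] := lt_n i.
by have := aD i; rewrite inE.
Qed.

Lemma down3_compress n f : down3 (compress n f).
Proof. by move=> x y z z' lez; apply: leq_ltn_trans. Qed.

Lemma down2_compress n f : down3 f -> down2 (compress n f).
Proof.
move=> df x y z y' ley /leq_trans; apply; apply: leq_sum => a _.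
by case fa: (f a x y) => //; rewrite (df _ _ _ _ ley fa).
Qed.

Lemma down1_compress n f : down2 f -> down1 (compress n f).
Proof.
move=> df x y z x' lex /leq_trans; apply; apply: leq_sum => a _.
by case fa: (f a x y) => //; rewrite (df _ _ _ _ lex fa).
Qed.

(** * Downsets, volumes of boxes, and the reduction to downsets *)

Definition downset f := [/\ down1 f, down2 f & down3 f].

Lemma downset_rot f : downset f -> downset (rot f).
Proof.
move=> [d1 d2 d3]; split=> x y z w le_w; rewrite /rot.
- exact: d2.
- exact: d3.
- exact: d1.
Qed.

Lemma vol_le n f g :
  (forall x y z, x < n -> y < n -> z < n -> f x y z <= g x y z) ->
  vol n f <= vol n g.
Proof.
move=> le_fg; apply: leq_sum => x _; apply: leq_sum => y _.
by apply: leq_sum => z _; apply: le_fg.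
Qed.

Lemma volD n f g : vol n (fun x y z => f x y z + g x y z) = vol n f + vol n g.
Proof.
rewrite /vol -big_split; apply: eq_bigr => x _.
by rewrite -big_split; apply: eq_bigr => y _; rewrite -big_split.
Qed.

Lemma vol_box n (a b c : nat -> nat) :
  vol n (fun x y z => a x * b y * c z) =
  (\sum_(x < n) a x) * (\sum_(x < n) b x) * (\sum_(x < n) c x).
Proof.
rewrite /vol big_distrl /= big_distrl /=; apply: eq_bigr => x _ /=.
rewrite [a x * _]big_distrr /= big_distrl; apply: eq_bigr => y _ /=.
by rewrite big_distrr.
Qed.

Lemma vol_interval_box n a b c a' b' c' : a' <= n -> b' <= n -> c' <= n ->
  vol n (fun x y z => (a <= x < a') * (b <= y < b') * (c <= z < c')) =
  (a' - a) * (b' - b) * (c' - c).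
Proof.
by move=> la lb lc; rewrite (vol_box n (fun x => a <= x < a') (fun x => b <= x < b')
  (fun x => c <= x < c')) !sum_interval.
Qed.

Definition rainbow_bound k :=
  forall n (F : 'I_k -> nat -> nat -> nat -> bool),
    (forall i, (k - 1) * n ^ 2 < card3 n (F i)) -> rainbow n F.

Lemma rainbow_bound_downset k :
  (forall n (F : 'I_k -> nat -> nat -> nat -> bool),
    (forall i, downset (F i)) ->
    (forall i, (k - 1) * n ^ 2 < card3 n (F i)) -> rainbow n F) ->
  rainbow_bound k.
Proof.
move=> bound n F ltF.
do 3!apply: rainbow_compress.
apply: bound => i; last by rewrite !card3_compress.
(* Each compression creates [down3] and, by the shift of coordinates, turns [down3] into [down2] and
   [down2] into [down1]. *)
by split; [apply: down1_compress; apply: down2_compress | apply: down2_compress | ];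
  apply: down3_compress.
Qed.

(** * The corner case: deleting a layer *)

Lemma fresh_value K (y : 'I_K -> nat) :
  exists2 v, v <= K & forall j, y j != v.
Proof.
have [v nv] : exists v : 'I_K.+1, v \notin [set inord (y j) | j in 'I_K].
  apply/existsP; rewrite -negb_forall; apply/negP => /forallP allv.
  have := leq_imset_card (fun j => inord (y j) : 'I_K.+1) (mem 'I_K).
  have -> : [set inord (y j) | j in 'I_K] = [set: 'I_K.+1].
    by apply/setP => v; rewrite in_setT allv.
  by rewrite cardsT !card_ord ltnn.
exists v => [|j]; first exact: (ltn_ord v).
by apply: contraNneq nv => yj; apply/imsetP; exists j; rewrite // yj inord_val.
Qed.

Lemma rainbow_of_corner K n (F : 'I_K.+1 -> nat -> nat -> nat -> bool) c :
  rainbow_bound K -> (forall i, downset (F i)) -> K < n ->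
  (forall i, K * n ^ 2 < card3 n (F i)) -> F c 0 K K -> rainbow n F.
Proof.
move=> boundK dF ltKn ltF Fc.
pose F' j x y z := F (lift c j) x y z && (0 < x).
have [|x [y [z [xI yI zI lt_n Fxyz]]]] := boundK n F'.
  move=> j; have := ltF (lift c j).
  have K1 : 0 < K by case: (K) j => // -[].
  (* The deleted layer [x = 0] has [n ^ 2] points, exactly the drop in the bound from [K + 1] to [K]
     colours. *)
  suff : card3 n (F (lift c j)) <= card3 n (F' j) + n ^ 2.
    by rewrite -[K in K * _](prednK K1) mulSnr -subn1; lia.
  have -> : n ^ 2 = (1 - 0) * (n - 0) * (n - 0) by rewrite !subn0 mul1n.
  rewrite -(@vol_interval_box n) ?(leq_ltn_trans _ ltKn) // -volD.
  apply: vol_le => u v w _ ltv ltw.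
  by rewrite /F' ltv ltw; case: (F _ u v w); case: u.
have [y0 ley0 ny0] := fresh_value y.
have [z0 lez0 nz0] := fresh_value z.
have x_gt0 j : 0 < x j by have /andP[] := Fxyz j.
pose ext v (u : 'I_K -> nat) i := if unlift c i is Some j then u j else v.
have extI v u : injective u -> (forall j, u j != v) -> injective (ext v u).
  move=> uI nu i i'; rewrite /ext.
  case: unliftP => [j ->|->]; case: unliftP => [j' ->|->] //.
  - by move/uI => ->.
  - by move/eqP; rewrite (negPf (nu _)).
  - by move/esym/eqP; rewrite (negPf (nu _)).
exists (ext 0 x), (ext y0 y), (ext z0 z); split.
- by apply: extI => // j; have := x_gt0 j; case: (x j).
- exact: extI.
- exact: extI.
- move=> i; rewrite /ext; case: unliftP => [j _|_]; first exact: lt_n.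
  by split; lia.
- move=> i; rewrite /ext; case: unliftP => [j ->|->].
    by have /andP[] := Fxyz j.
  have [_ d2 d3] := dF c.
  by apply: d2 ley0 _; apply: d3 lez0 _.
Qed.

(** * Counting in a downset without corners *)

Section NoCorner.
Variables (K d : nat) (f : nat -> nat -> nat -> bool).
Hypotheses (df : downset f) (lt_f : K * (K + d) ^ 2 < card3 (K + d) f).
Hypotheses (f1 : ~~ f 0 K K) (f2 : ~~ f K 0 K) (f3 : ~~ f K K 0).
Let n := K + d.
Let lo x : bool := 0 <= x < K.

Lemma no_corner x y z :
  f x y z -> [|| lo x && lo y, lo x && lo z | lo y && lo z].
Proof.
move=> fxyz; rewrite /lo /=; case: df => d1 d2 d3.
case: (ltnP x K) => lex; case: (ltnP y K) => ley; case: (ltnP z K) => lez //=; exfalso.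
- by move/negP: f1; apply; apply: d1 (leq0n x) _; apply: d2 ley _; apply: d3 lez _.
- by move/negP: f2; apply; apply: d1 lex _; apply: d2 (leq0n y) _; apply: d3 lez _.
- by move/negP: f3; apply; apply: d1 lex _; apply: d2 ley _; apply: d3 (leq0n z) _.
- by move/negP: f1; apply; apply: d1 (leq0n x) _; apply: d2 ley _; apply: d3 lez _.
Qed.

(** Two coordinates of each point lie below [K], so the size is at most [K^3 + 3 K^2 d]. Exceeding
    [K (K + d)^2] then means [K d^2 < K^2 d]. *)
Lemma no_corner_lt : d < K.
Proof.
rewrite ltnNge; apply/negP => leKd; move: lt_f.
suff : card3 n f <=
    (K - 0) * (K - 0) * (K - 0) + (K - 0) * (K - 0) * (n - K) +
    (K - 0) * (n - K) * (K - 0) + (n - K) * (K - 0) * (K - 0).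
  rewrite !subn0 /n; nia.
rewrite -!(@vol_interval_box n) ?leq_addr // -!volD.
apply: vol_le => x y z ltx lty ltz.
case fxyz: (f x y z) => //; have := no_corner fxyz.
by rewrite /lo ltx lty ltz !andbT; case: (ltnP x K); case: (ltnP y K); case: (ltnP z K).
Qed.

(** If [(a, b, K)] were missing, so would be the box [[a, K) x [b, K) x [K, n)]. Subtracting it from
    the previous count leaves [K d < K (a + b) - a b], contrary to [a + b <= d]. *)
Lemma no_corner_face a b : a + b <= d -> f a b K.
Proof.
move=> leab; apply/negPn/negP => nf; move: lt_f no_corner_lt.
suff : card3 n f + (K - a) * (K - b) * (n - K) <=
    (K - 0) * (K - 0) * (K - 0) + (K - 0) * (K - 0) * (n - K) +
    (K - 0) * (n - K) * (K - 0) + (n - K) * (K - 0) * (K - 0).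
  rewrite !subn0 /n => le1 lt2 ltd.
  have [u Ku] : exists u, K = a + b + u by exists (K - (a + b)); lia.
  have [v dv] : exists v, d = a + b + v by exists (d - (a + b)); lia.
  have e1 : K - a = b + u by lia.
  have e2 : K - b = a + u by lia.
  have e3 : K + d - K = d by lia.
  rewrite e1 e2 e3 in le1.
  have : K * K <= K * d + (b + u) * (a + u) by nia.
  nia.
rewrite -!(@vol_interval_box n) ?leq_addr // -!volD.
apply: vol_le => x y z ltx lty ltz.
have [d1 d2 d3] := df.
case fxyz: (f x y z); last first.
  rewrite ltx lty ltz !andbT; case: (ltnP x K); case: (ltnP y K);
    by case: (ltnP z K); case: (a <= x); case: (b <= y).
have nab : a <= x -> b <= y -> K <= z -> false.
  move=> ax bY Kz; rewrite -(negPf nf).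
  by apply: d1 ax _; apply: d2 bY _; apply: d3 Kz _.
have := no_corner fxyz.
rewrite /lo ltx lty ltz !andbT; move: nab.
case: (ltnP x K); case: (ltnP y K); case: (ltnP z K);
  by case: (a <= x); case: (b <= y) => //= _ _ _ /(_ isT isT isT).
Qed.

(** At most [K^2 d] points of [f] have [z >= K], so more than [K n^2 - K^2 d] of the [K n^2] triples
    with [z < K] belong to [f]. *)
Lemma no_corner_misses :
  vol n (fun x y z => ~~ f x y z && (z < K)) < d * K ^ 2.
Proof.
have e : vol n (fun x y z => ~~ f x y z && (z < K)) +
    vol n (fun x y z => f x y z && (z < K)) = n * n * K.
  have -> : n * n * K = (n - 0) * (n - 0) * (K - 0) by rewrite !subn0.
  rewrite -volD -(@vol_interval_box n) ?leq_addr //.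
  apply: eq_bigr => x _; apply: eq_bigr => y _; apply: eq_bigr => z _.
  by rewrite !ltn_ord /= !mul1n; case: f; case: ltnP.
have : card3 n f <= vol n (fun x y z => f x y z && (z < K)) + (K - 0) * (K - 0) * (n - K).
  rewrite -!(@vol_interval_box n) ?leq_addr // -!volD.
  apply: vol_le => x y z ltx lty ltz.
  case fxyz: (f x y z) => //; have := no_corner fxyz.
  by rewrite /lo ltz !andbT; case: (ltnP x K); case: (ltnP y K); case: (ltnP z K).
by move: lt_f e; rewrite !subn0 /n; nia.
Qed.

End NoCorner.

(** * Slots and their assignment to colours *)

Lemma sum_rotate K (j : nat) (g : nat -> nat) :
  \sum_(r < K) g ((j + r) %% K) = \sum_(u < K) g u.
Proof.
case: K => [|K]; first by rewrite !big_ord0.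
pose h (r : 'I_K.+1) := Ordinal (ltn_pmod (j + r) (ltn0Sn K)).
rewrite [RHS](reindex_inj (h := h)) // => r r' /(congr1 val) /= /eqP.
by rewrite eqn_modDl !modn_small // => /eqP/val_inj.
Qed.

(** The last [K] slots always lie in the subcube [x, y >= d], [z < K]; [g] will be the complement of
    a family. *)
Lemma vol_subcube K d (g : nat -> nat -> nat -> bool) :
  \sum_(j < K) \sum_(u < K) \sum_(v < K) g (d + u) (d + v) j <=
  vol (K + d) (fun x y z => g x y z && (z < K)).
Proof.
have sum_shift (e : nat -> nat) : \sum_(u < K) e (d + u) <= \sum_(x < K + d) e x.
  by rewrite addnC big_split_ord leq_addl.
rewrite /vol; under [leqRHS]eq_bigr => x _ do rewrite exchange_big.
rewrite [leqRHS]exchange_big big_split_ord /=.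
apply: leq_trans (leq_addr _ _); apply: leq_sum => j _.
apply: leq_trans (sum_shift (fun x => \sum_(y < K + d) (g x y j && (j < K)))).
apply: leq_sum => u _.
apply: leq_trans (sum_shift (fun y => (g (d + u) y j && (j < K)) : nat)).
by apply: leq_sum => v _; rewrite ltn_ord andbT.
Qed.

(** Take for [z' i] the number of values below [z i]: these are distinct naturals, coming from at
    most [k] other indices. Distinctness thus survives truncation at [k]. *)
Lemma injective_rank k (z : 'I_k.+1 -> nat) : injective z ->
  exists2 z' : 'I_k.+1 -> nat, injective z' & forall i, z' i <= minn (z i) k.
Proof.
move=> zI; pose below i := [set j | z j < z i].
have below_proper i j : z i < z j -> #|below i| < #|below j|.
  move=> ltz; apply: proper_card; apply/properP; split.
    by apply/subsetP => l; rewrite !inE => /ltn_trans; apply.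
  by exists i; rewrite !inE ?ltnn.
exists (fun i => #|below i|) => [i j eqij|i].
  by apply: zI; case: (ltngtP (z i) (z j)) => // /below_proper; rewrite eqij ltnn.
rewrite leq_min; apply/andP; split.
  rewrite -[leqRHS](size_iota 0) cardE -(size_map z); apply: uniq_leq_size.
    by rewrite (map_inj_uniq zI) enum_uniq.
  by move=> _ /mapP[j + ->]; rewrite mem_enum inE mem_iota.
rewrite -ltnS -[ltnRHS]card_ord -cardsT; apply: proper_card.
by apply/properP; split; [apply: subsetT | exists i; rewrite !inE ?ltnn].
Qed.

Lemma rainbow_of_no_corner K d (F : 'I_K.+1 -> nat -> nat -> nat -> bool) :
  0 < d -> (forall i, downset (F i)) ->
  (forall i, K * (K + d) ^ 2 < card3 (K + d) (F i)) ->
  (forall i, [/\ ~~ F i 0 K K, ~~ F i K 0 K & ~~ F i K K 0]) ->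
  rainbow (K + d) F.
Proof.
move=> d_gt0 dF ltF nF.
have ltdK : d < K by have [] := nF ord0; apply: (no_corner_lt (dF _) (ltF _)).
have face i a b : a + b <= d -> F i a b K.
  by move=> leab; have [c1 c2 c3] := nF i; apply: no_corner_face leab.
pose miss r s i : nat :=
  \sum_(j < K) ~~ F i (d + (j + r) %% K) (d + (j + s) %% K) j.
(* For fixed [j], varying [r] and [s] moves the slot once through each [(d + u, d + v, j)]. Hence
   the total number of misses, averaged over the [K ^ 2] pairs, is below [(K + 1) d]. *)
have [r [s ltM]] : exists r s, \sum_i miss r s i < K.+1 * d.
  have avg : \sum_(r < K) \sum_(s < K) \sum_i miss r s i < K.+1 * (d * K ^ 2).
    under eq_bigr => r _ do rewrite exchange_big.
    rewrite exchange_big /= -[K.+1 in ltnRHS]card_ord -sum_nat_const.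
    rewrite [ltnLHS](eq_bigr (fun i => \sum_(j < K) \sum_(u < K) \sum_(v < K)
        ~~ F i (d + u) (d + v) j)); last first.
      move=> i _; rewrite /miss; under eq_bigr => r _ do rewrite exchange_big.
      rewrite exchange_big; apply: eq_bigr => j _ /=.
      rewrite -(sum_rotate K j (fun u => \sum_(v < K) ~~ F i (d + u) (d + v) j)).
      apply: eq_bigr => r _.
      by rewrite -(sum_rotate K j (fun v => (~~ F i (d + (j + r) %% K) (d + v) j) : nat)).
    have lt_i i : \sum_(j < K) \sum_(u < K) \sum_(v < K)
        ~~ F i (d + u) (d + v) j < d * K ^ 2.
      apply: leq_ltn_trans (vol_subcube _ _ (fun x y z => ~~ F i x y z)) _.
      by have [] := nF i; apply: (no_corner_misses (dF _) (ltF _)).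
    rewrite [ltnLHS]big_ord_recl [ltnRHS]big_ord_recl -addSn.
    by apply: leq_add; [apply: lt_i | apply: leq_sum => i _; apply: ltnW].
  have /existsP[r /existsP[s ltM]] : [exists r : 'I_K, [exists s : 'I_K,
      \sum_i miss r s i < K.+1 * d]].
    apply: contraT => /existsPn geM.
    move: avg; rewrite ltnNge => /negP[].
    have -> : K.+1 * (d * K ^ 2) = \sum_(r < K) \sum_(s < K) K.+1 * d.
      by rewrite !sum_nat_const !card_ord; lia.
    apply: leq_sum => r _; apply: leq_sum => s _.
    by have /existsPn/(_ s) := geM r; rewrite -leqNgt.
  by exists r, s.
pose X a := if a < d then a else d + (a - d + r) %% K.
pose Y a := if a < d then d.-1 - a else d + (a - d + s) %% K.
(* The value [K + a] keeps [Z] injective; [D] tests only its truncation to [K], and ranking lowers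
   it at the end. *)
pose Z a := if a < d then K + a else a - d.
have K_gt0 : 0 < K by lia.
have inj_mod t a b : a < K -> b < K -> (a + t) %% K = (b + t) %% K -> a = b.
  by move=> lta ltb /eqP; rewrite eqn_modDr !modn_small // => /eqP.
have ltmod t : t %% K < K by rewrite ltn_pmod.
pose D i := [set a : 'I_(d + K) | F i (X a) (Y a) (minn (Z a) K)].
(* Slots [a < d] have [X a + Y a = d - 1], so by [face] they fit every colour. *)
have cardD i : #|D i| + miss r s i = d + K.
  rewrite -sum1dep_card big_mkcond big_split_ord /= -addnA -big_split /=.
  rewrite [X in X + _](eq_bigr (fun=> 1)) => [|a _]; last first.
    have lta := ltn_ord a.
    by rewrite /X /Y /Z lta (minn_idPr (leq_addr _ _)) face //; lia.
  rewrite [X in _ + X](eq_bigr (fun=> 1)) => [|a _]; last first.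
    rewrite /X /Y /Z ltnNge leq_addr /= addKn (minn_idPl _) ?(ltnW (ltn_ord a)) //.
    by case: (F i _ _ _).
  by rewrite !sum1_card !card_ord.
have lt0n : 0 < d + K by lia.
have [|f fI fD] := @greedy_sdr _ _ (Ordinal lt0n) D.
  move=> i; set B := [set j | _].
  (* Each [j] in [B] misses at least as many slots as [i]. *)
  have ltB : #|B| * miss r s i < K.+1 * d.
    apply: leq_ltn_trans ltM; rewrite -sum_nat_const.
    rewrite [leqRHS](bigID (mem B)) /=; apply: leq_trans (leq_addr _ _).
    apply: leq_sum => j; rewrite inE => leD.
    by have := cardD i; have := cardD j; lia.
  have leB : #|B| <= K.+1 by rewrite -[leqRHS]card_ord max_card.
  have leM : miss r s i <= K.
    exact: (sum_bool_le K (fun j => ~~ F i (d + (j + r) %% K) (d + (j + s) %% K) j)).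
  have cD := cardD i.
  rewrite leqNgt; apply/negP => ltDB.
  (* [b (K + 1 + d - b)] is concave in [b], with value [(K + 1) d] at both
     ends of the interval [d <= b <= K + 1]. *)
  have leBm : #|B| * (K.+1 + d - #|B|) <= #|B| * miss r s i by rewrite leq_mul2l; lia.
  nia.
have Zinj : injective (fun i => Z (f i)).
  move=> i j eqZ; apply: fI; apply: val_inj; move: eqZ => /=.
  rewrite /Z; have := ltn_ord (f i); have := ltn_ord (f j).
  by case: (ltnP (f i) d); case: (ltnP (f j) d); lia.
have [z zI lez] := injective_rank Zinj.
exists (fun i => X (f i)), (fun i => Y (f i)), z; split=> //.
- move=> i j eqX; apply: fI; apply: val_inj; move: eqX => /=.
  rewrite /X; have := ltn_ord (f i); have := ltn_ord (f j).
  case: (ltnP (f i) d) => lei; case: (ltnP (f j) d) => lej ltj lti; try lia.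
  by move/addnI/inj_mod; lia.
- move=> i j eqY; apply: fI; apply: val_inj; move: eqY => /=.
  rewrite /Y; have := ltn_ord (f i); have := ltn_ord (f j).
  case: (ltnP (f i) d) => lei; case: (ltnP (f j) d) => lej ltj lti; try lia.
  by move/addnI/inj_mod; lia.
- move=> i; have := lez i; rewrite leq_min => /andP[_ leK].
  have := ltmod (f i - d + r); have := ltmod (f i - d + s).
  by split; rewrite /X /Y; try case: (ltnP (f i) d); lia.
- move=> i; have [_ _ d3] := dF i.
  by apply: d3 (lez i) _; have := fD i; rewrite inE.
Qed.

(** * The induction, and the return to hypergraphs *)

Lemma rainbow_bound_all k : rainbow_bound k.
Proof.
elim: k => [|K boundK]; first by move=> n F _; do 3!exists (fun=> 0); split=> -[].
apply: rainbow_bound_downset => n F dF; rewrite subn1 /= => ltF.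
have ltKn : K < n.
  rewrite ltnNge; apply/negP => lenK.
  have := ltF ord0; rewrite ltnNge => /negP; apply.
  have : card3 n (F ord0) <= (n - 0) * (n - 0) * (n - 0).
    rewrite -(@vol_interval_box n) //; apply: vol_le => x y z ltx lty ltz.
    by rewrite ltx lty ltz leq_b1.
  by rewrite !subn0; nia.
have [/existsP[c Fc]|no1] := boolP [exists c, F c 0 K K]; first exact: rainbow_of_corner Fc.
have [/existsP[c Fc]|no2] := boolP [exists c, F c K K 0].
  (* Two rotations bring the corner [(K, K, 0)] to [(0, K, K)]; for [(K, 0, K)] one suffices. *)
  apply: rainbow_rot; apply: rainbow_rot; apply: (rainbow_of_corner (c := c)) => // i.
    by do 2!apply: downset_rot.
  by rewrite 2!card3_rot.
have [/existsP[c Fc]|no3] := boolP [exists c, F c K 0 K].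
  apply: rainbow_rot; apply: (rainbow_of_corner (c := c)) => // i; first exact: downset_rot.
  by rewrite card3_rot.
have -> : n = K + (n - K) by lia.
apply: rainbow_of_no_corner => // [|i|i].
- by rewrite subn_gt0.
- by rewrite subnKC // ltnW.
-
by split; [move: no1|move: no3|move: no2]; move/existsPn.
Qed.

Theorem theorem1p12 (n k : nat) (hn : 1 <= n) (hk : 1 <= k)
  (F : 'I_k -> {set triple n}) :
  (forall i, (k - 1) * n ^ 2 < #|F i|) ->
  exists e : 'I_k -> triple n, rainbow_matching F e.
Proof.
move=> ltF; pose i0 : 'I_n := Ordinal hn.
(* The default [i0] is harmless: [card3] and [rainbow] only evaluate [G] at coordinates below
   [n]. *)
pose G i x y z := (insubd i0 x, insubd i0 y, insubd i0 z) \in F i.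
have [|x [y [z [xI yI zI lt_n Gxyz]]]] := rainbow_bound_all (n := n) (F := G).
  move=> i; suff -> : card3 n (G i) = #|F i| by [].
  rewrite /card3 /vol pair_big pair_big /= -sum1_card [RHS]big_mkcond /=.
  rewrite [RHS](eq_bigr (fun t : triple n => (t \in F i) : nat)); last first.
    by move=> t _; case: (t \in F i).
  by apply: eq_bigr => -[[a b] c] _; rewrite /G !valKd.
exists (fun i => (insubd i0 (x i), insubd i0 (y i), insubd i0 (z i))).
split=> // i j ij; rewrite -setI_eq0; apply/eqP/setP => -[s v]; rewrite !inE /=.
(* A common vertex on side [s] makes the two edges agree in that coordinate, against its
   injectivity. *)
apply/negP => /andP[/eqP-> /eqP/(congr1 val)]; rewrite /coord.
have [xi yi zi] := lt_n i; have [xj yj zj] := lt_n j.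
case: (val s) => [|[|_]] /=; rewrite !val_insubd ?xi ?yi ?zi ?xj ?yj ?zj;
  by [move/xI/eqP; rewrite (negPf ij) | move/yI/eqP; rewrite (negPf ij)
    | move/zI/eqP; rewrite (negPf ij)].
Qed.
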